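(* (Weak duality) Let $Z,Y$ be Asplund spaces, $f:Z\to Y$ locally Lipschitz, $K\subset Y$ a pointed closed convex cone, $\mathcal{U}$ a sequentially compact topological space, and $g=(g_1,\dots,g_n)$ with $g_i:Z\times\mathcal{U}\to\mathbb{R}$. Let $z\in F$ and let $(y,y^*,\mu)\in F_{MW}$. (i) If $(f,g)$ is type I pseudo convex at $y$, then $f(z)\nprec\bar f(y,y^*,\mu)$, i.e. $f(z)-f(y)\notin-\mathrm{int}\,K$. (ii) If $(f,g)$ is type II pseudo convex at $y$, then $f(z)\not\preceq\bar f(y,y^*,\mu)$, i.e. $f(z)-f(y)\notin-K\setminus\{0\}$.
   Context: Notation. $Z^*,Y^*$ are the topological duals; $\mathrm{cl}^*$ is weak$^*$ closure, $\mathrm{co}$ convex hull, $\mathrm{int}$ topological interior. $K$ pointed means $K\cap(-K)=\{0\}$. The dual cone is $K^+=\{y^*\in Y^*\mid \langle y^*,y\rangle\ge 0\ \forall y\in K\}$. $\langle y^*,f\rangle(z):=\langle y^*,f(z)\rangle$. $\mathbb{R}^n_+$ is the nonnegative orthant. $a\prec b$ means $a-b\in-\mathrm{int}\,K$; $a\preceq b$ means $a-b\in-K\setminus\{0\}$; $\nprec,\not\preceq$ are their negations. Primal feasible set: $F=\{z\in Z\mid g_i(z,u)\le 0\ \forall u\in\mathcal{U},\ i=1,\dots,n\}$. $\mathcal{U}_i(y):=\{u\in\mathcal{U}\mid g_i(y,u)=\max_{u'\in\mathcal{U}}g_i(y,u')\}$. Mond–Weir dual: $\bar f(y,y^*,\mu):=f(y)$,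 with feasible set $F_{MW}$ consisting of all $(y,y^*,\mu)\in Z\times(K^+\setminus\{0\})\times\mathbb{R}^n_+$ for which there exist $u_i^*\in\mathrm{cl}^*\mathrm{co}\big(\bigcup\{\partial_z g_i(y,u)\mid u\in\mathcal{U}_i(y)\}\big)$, $i=1,\dots,n$, with $0\in\partial\langle y^*,f\rangle(y)+\sum_{i=1}^n\mu_i u_i^*$, and such that $\mu_i g_i(y,u)\ge 0$ for all $u\in\mathcal{U}_i(y)$, $i=1,\dots,n$. Generalized convexity (at a point $\bar z\in Z$). - $f$ is pseudo convex at $\bar z$ if for all $z\in Z$, $y^*\in K^+$: $\langle y^*,f\rangle(z)<\langle y^*,f\rangle(\bar z)$ implies $\langle v^*,z-\bar z\rangle<0$ for all $v^*\in\partial\langle y^*,f\rangle(\bar z)$. - $f$ is strictly pseudo convex at $\bar z$ if for all $z\in Z\setminus\{\bar z\}$, $y^*\in K^+\setminus\{0\}$: $\langle y^*,f\rangle(z)\le\langle y^*,f\rangle(\bar z)$ implies $\langle v^*,z-\bar z\rangle<0$ for all $v^*\in\partial\langle y^*,f\rangle(\bar z)$. - $g$ is generalized quasi convex at $\bar z$ if for all $z\in Z$, $u\in\mathcal{U}$ and $i=1,\dots,n$: $g_i(z,u)\le g_i(\bar z,u)$ implies $\langle u_i^*,z-\bar z\rangle\le 0$ for all $u_i^*\in\partial_z g_i(\bar z,u)$. - $(f,g)$ is type I (resp. type II) pseudo convex at $\bar z$ if $f$ is pseudo convex (resp. strictly pseudo convex) and $g$ is generalized quasi convex at $\bar z$.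 Subdifferential. For $\Gamma$ locally closed around $\bar x\in\Gamma$: the Fréchet normal cone is $\widehat N(\bar x;\Gamma)=\{x^*\mid\limsup_{x\to\bar x,\,x\in\Gamma}\langle x^*,x-\bar x\rangle/\|x-\bar x\|\le 0\}$, and the Mordukhovich normal cone $N(\bar x;\Gamma)$ is the set of $x^*$ for which there are sequences $x_k\to\bar x$, $x_k\in\Gamma$, and $x_k^*\in\widehat N(x_k;\Gamma)$ with $x_k^*\to x^*$ weak$^*$. The limiting (Mordukhovich) subdifferential of $\varphi:Z\to\overline{\mathbb{R}}$ at $\bar z$ with $\varphi(\bar z)$ finite is $\partial\varphi(\bar z)=\{z^*\in Z^*\mid(z^*,-1)\in N((\bar z,\varphi(\bar z));\mathrm{epi}\,\varphi)\}$. $\partial_z g_i(z,u)$ is the limiting subdifferential of $g_i(\cdot,u)$ at $z$. *)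

(* Defs.v *)
From HB Require Import structures.
From mathcomp Require Import all_boot all_order all_algebra.
From mathcomp Require Import all_classical all_reals all_analysis.
From mathcomp Require Import borel_hierarchy.

Set Implicit Arguments.
Unset Strict Implicit.
Unset Printing Implicit Defensive.

Import Order.TTheory GRing.Theory Num.Theory.
Import numFieldNormedType.Exports.

Local Open Scope classical_set_scope.
Local Open Scope ring_scope.

Section Dual.
Context (R : realType) (X : normedModType R).

Definition continuous_linear : {pred X -> R^o} :=
  mem [set f : X -> R^o | linear f /\ continuous f].

Record dual := Dual {
  dual_fun :> X -> R^o ;
  dual_funP : dual_fun \in continuous_linear }.

Lemma continuous_linear_submod_closed : submod_closed continuous_linear.
Proof.
split=> [|a f h]; rewrite !inE => /=.
  split; last exact: cst_continuous.
  by move=> k u v; rewrite /= scaler0 addr0.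
move=> [lf cf] [lh ch]; split.
  move=> k u v; rewrite !fctE lf lh !scalerDr !scalerA [a * k]mulrC.
  by rewrite addrACA.
move=> x; apply: cvgD; last exact: ch.
by apply: cvgZr; exact: cf.
Qed.

HB.instance Definition _ := [isSub for dual_fun].
HB.instance Definition _ := [Choice of dual by <:].
HB.instance Definition _ := GRing.isSubmodClosed.Build _ _ continuous_linear
  continuous_linear_submod_closed.
HB.instance Definition _ := [SubChoice_isSubLmodule of dual by <:].

(* The dual with its weak* topology, i.e. that of pointwise convergence. *)
Definition weak_star : Type :=
  initial_topology (dual_fun : dual -> {ptws X -> R}).

HB.instance Definition _ := Topological.copy weak_star
  (initial_topology (dual_fun : dual -> {ptws X -> R})).

Definition weak_star_closure (A : set dual) : set dual :=
  closure (A : set weak_star).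

Definition convex_hull (A : set dual) : set dual :=
  smallest (@convex_set R dual) A.

End Dual.

Section PairDual.
Context (R : realType) (X : normedModType R).

Lemma pair_dual_subproof (xs : dual X) (r : R) :
  (fun p : X * R^o => xs p.1 + r * p.2 : R^o) \in
  @continuous_linear R (X * R^o)%type.
Proof.
have := dual_funP xs; rewrite !inE => -[lxs cxs]; split.
  move=> k [u1 u2] [v1 v2] /=; rewrite lxs scalerDr addrACA; congr (_ + _).
  by rewrite mulrDr mulrCA.
move=> p; apply: cvgD.
  by apply: continuous_comp; [exact: cvg_fst|exact: cxs].
by apply: cvgM; [exact: cvg_cst|exact: cvg_snd].
Qed.

(* The pair (xs, r), seen as an element of the dual of X * R. *)
Definition pair_dual (xs : dual X) (r : R) : dual (X * R^o)%type :=
  Dual (pair_dual_subproof xs r).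

End PairDual.

Section Asplund.
Context (R : realType).

(* Completeness is part of the type: an Asplund space is a Banach space. *)
Definition asplund (X : completeNormedModType R) :=
  forall (D : set X) (phi : X -> R^o),
    open D -> @convex_set R X D -> @convex_function R X D phi ->
    {in D, continuous phi} ->
    exists G : set X, [/\ Gdelta G, G `<=` D, D `<=` closure G &
      forall x, G x -> differentiable phi x].

End Asplund.

Section Subdifferential.
Context (R : realType).

Definition frechet_normal_cone (X : normedModType R) (C : set X) (xb : X) :
    set (dual X) :=
  [set xs : dual X | (limf_esup
     (fun x : X => (xs (x - xb) / `|x - xb|)%:E) (within C xb^') <= 0)%E].

Definition normal_cone (X : normedModType R) (C : set X) (xb : X) :
    set (dual X) :=
  [set xs : dual X | exists (x_ : nat -> X) (xs_ : nat -> weak_star X),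
    [/\ x_ @ \oo --> xb, forall k, C (x_ k),
        forall k, frechet_normal_cone C (x_ k) (xs_ k) &
        xs_ @ \oo --> (xs : weak_star X)]].

Definition epigraph (X : Type) (phi : X -> \bar R) : set (X * R^o) :=
  [set p | (phi p.1 <= p.2%:E)%E].

Definition subdifferential (X : normedModType R) (phi : X -> \bar R) (xb : X) :
    set (dual X) :=
  [set xs : dual X | phi xb \is a fin_num /\
    normal_cone (epigraph phi) (xb, fine (phi xb)) (pair_dual xs (-1))].

Definition rsubdifferential (X : normedModType R) (phi : X -> R) :=
  subdifferential (fun x => (phi x)%:E).

End Subdifferential.

Definition locally_lipschitz (R : realType) (X Y : normedModType R)
    (f : X -> Y) :=
  forall x : X, exists2 V : set X, nbhs x V & [lipschitz f z | z in V].

Definition sequentially_compact (T : topologicalType) :=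
  forall u : nat -> T, exists (e : nat -> nat) (l : T),
    {homo e : m n / (m < n)%N} /\ (u \o e) @ \oo --> l.

Section Cone.
Context (R : realType) (Y : normedModType R).
Implicit Type K : set Y.

Definition opp_set K : set Y := [set - k | k in K].

Definition is_cone K := forall (t : R) k, 0 <= t -> K k -> K (t *: k).

Definition pointed_cone K := K `&` opp_set K = [set 0].

Definition pointed_closed_convex_cone K :=
  [/\ is_cone K, @convex_set R Y K, closed K & pointed_cone K].

Definition dual_cone K : set (dual Y) :=
  [set ys : dual Y | forall k, K k -> 0 <= ys k].

Definition prec K (a b : Y) := opp_set K° (a - b).

Definition preceq K (a b : Y) := (opp_set K `\ 0) (a - b).

End Cone.

Section RobustProblem.
Context (R : realType) (Z Y : normedModType R) (U : Type) (n : nat).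
Variables (K : set Y) (f : Z -> Y) (g : 'I_n -> Z -> U -> R).

Definition scalarize (ys : dual Y) : Z -> R := fun z => ys (f z).

Definition feasible : set Z := [set z | forall u i, g i z u <= 0].

(* Empty when the maximum over U is not attained. *)
Definition active (i : 'I_n) (y : Z) : set U :=
  [set u | forall u', g i y u' <= g i y u].

Definition orthant : set 'rV[R]_n := [set mu | forall i, 0 <= mu ord0 i].

Definition feasible_MW : set (Z * dual Y * 'rV[R]_n) :=
  [set p | let: (y, ys, mu) := p in
    [/\ (dual_cone K `\ 0) ys,
        orthant mu,
        exists us : 'I_n -> dual Z,
          (forall i, weak_star_closure (convex_hull
             (\bigcup_(u in active i y) rsubdifferential (g i ^~ u) y)) (us i))
          /\ [set v + \sum_(i < n) mu ord0 i *: us i |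
                v in rsubdifferential (scalarize ys) y] 0 &
        forall i u, active i y u -> 0 <= mu ord0 i * g i y u]].

Definition objective_MW (p : Z * dual Y * 'rV[R]_n) : Y := f p.1.1.

Definition pseudo_convex (zb : Z) :=
  forall z (ys : dual Y), dual_cone K ys ->
    scalarize ys z < scalarize ys zb ->
    forall vs, rsubdifferential (scalarize ys) zb vs -> vs (z - zb) < 0.

Definition strictly_pseudo_convex (zb : Z) :=
  forall z (ys : dual Y), z != zb -> (dual_cone K `\ 0) ys ->
    scalarize ys z <= scalarize ys zb ->
    forall vs, rsubdifferential (scalarize ys) zb vs -> vs (z - zb) < 0.

Definition generalized_quasi_convex (zb : Z) :=
  forall z u i, g i z u <= g i zb u ->
    forall us, rsubdifferential (g i ^~ u) zb us -> us (z - zb) <= 0.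

Definition type_I_pseudo_convex (zb : Z) :=
  pseudo_convex zb /\ generalized_quasi_convex zb.

Definition type_II_pseudo_convex (zb : Z) :=
  strictly_pseudo_convex zb /\ generalized_quasi_convex zb.

End RobustProblem.

(* Main.v *)
Require Import Defs.
From mathcomp Require Import all_boot all_order all_algebra.
From mathcomp Require Import all_classical all_reals all_analysis.
Import Order.TTheory GRing.Theory Num.Theory.
Import numFieldNormedType.Exports.
Local Open Scope classical_set_scope.
Local Open Scope ring_scope.

(** Dual feasibility provides a subgradient v of the scalarized objective at y
such that v + \sum_i mu_i u_i vanishes, so it is enough to see that
each mu_i u_i is nonpositive in the direction z - y: then v is nonnegative in
that direction, whereas pseudo convexity of f makes every subgradient of the
scalarized objective negative there as soon as z improves on y in that objective.

The sign of mu_i u_i is clear when mu_i = 0. When mu_i > 0, feasibility of both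
points gives g_i(y, u) >= 0 >= g_i(z, u) at each active u, and generalized quasi
convexity puts all the subgradients of g_i(., u) at y in the half-space
{w | w (z - y) <= 0} of the dual. This half-space is convex and weak* closed
([weak_star_closure_convex_hull_le0]), so it still contains u_i, which lies in
the weak* closed convex hull of those subgradients.

It remains to see that z improves on y in the scalarization by ys. In case (ii)
this is the weak inequality ys (f z) <= ys (f y), immediate from ys being in the
dual cone; in case (i) the strict one is needed, and holds because a nonzero
functional nonnegative on K is positive on the interior of K
([dual_cone_interior_gt0]). *)

Section DualEvaluation.
Context {R : realType} {X : normedModType R}.
Implicit Types (v w : dual X) (x : X).

Lemma dualD v x x' : v (x + x') = v x + v x'.
Proof.
by have := dual_funP v; rewrite inE => -[lv _]; have := lv 1 x x'; rewrite !scale1r.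
Qed.

Lemma dual0 v : v 0 = 0.
Proof. by apply: (addrI (v 0)); rewrite -dualD !addr0. Qed.

Lemma dualZ v (t : R) x : v (t *: x) = t * v x.
Proof.
have := dual_funP v; rewrite inE => -[lv _].
by have := lv t x 0; rewrite !addr0 dual0 addr0.
Qed.

Lemma dualN v x : v (- x) = - v x.
Proof. by rewrite -scaleN1r dualZ mulN1r. Qed.

Lemma dualB v x x' : v (x - x') = v x - v x'.
Proof. by rewrite dualD dualN. Qed.

Lemma dual_sumE n (c : 'I_n -> R) (w : 'I_n -> dual X) x :
  (\sum_(i < n) c i *: w i : dual X) x = \sum_(i < n) c i * w i x.
Proof. by rewrite (big_morph (fun v : dual X => v x) (id1 := 0) (op1 := +%R)). Qed.

Lemma weak_star_eval_continuous x :
  continuous (fun v : weak_star X => dual_fun v x : R).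
Proof.
move=> v.
have cdual : {for v, continuous (@dual_fun R X : weak_star X -> {ptws X -> R})}.
  exact: initial_continuous.
exact: cvg_comp cdual (@proj_continuous X (fun=> R) x _).
Qed.

Lemma convex_dual_le0 x : @convex_set R (dual X) [set v : dual X | v x <= 0].
Proof.
move=> v w t /[!inE]/= vx wx.
rewrite -[X in X <= 0]/(t%:num * v x + (1 - t%:num) * w x).
by rewrite -[leRHS]addr0 lerD // mulr_ge0_le0 // subr_ge0.
Qed.

(** Evaluation at x is linear and weak* continuous, so the half-space where it
is nonpositive is a weak* closed convex set containing A. *)
Lemma weak_star_closure_convex_hull_le0 {A : set (dual X)} {x} :
  (forall v, A v -> v x <= 0) ->
  forall v, weak_star_closure (convex_hull A) v -> v x <= 0.
Proof.
move=> Ax; pose H : set (dual X) := [set v | v x <= 0].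
have clH : closed (H : set (weak_star X)).
  have /continuous_closedP := @weak_star_eval_continuous x.
  by move=> /(_ [set r | r <= 0]); apply; exact: closed_le.
suff hullH : convex_hull A `<=` H.
  move=> v /(closureS (hullH : (_ : set (weak_star X)) `<=` _)).
  by move/closure_id : clH => <-.
by apply: smallest_sub => //; exact: convex_dual_le0.
Qed.

(** If ys vanished at the interior point k, then the points k + t h and
k - t h, which lie in K for small t > 0, would force ys h = 0 for every h. *)
Lemma dual_cone_interior_gt0 {K : set X} {ys : dual X} {k} :
  (dual_cone K `\ 0) ys -> K° k -> 0 < ys k.
Proof.
move=> [Kys /= ys0] Kk; rewrite lt_neqAle Kys ?andbT; last exact: interior_subset Kk.
apply/eqP => ysk0; apply: ys0.
suff ge0 h : 0 <= ys h.
  apply/val_inj/funext => h; apply/le_anti; rewrite ge0 andbT.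
  by have := ge0 (- h); rewrite dualN oppr_ge0.
have : (fun t : R => k + t *: h) @ 0^'+ --> k.
  apply: cvg_at_right_filter; rewrite -[X in _ --> X]addr0 -[X in _ + X](scale0r h).
  by apply: cvgD; [exact: cvg_cst|apply: cvgZr_tmp; exact: cvg_id].
move=> /(_ _ Kk) /= nK.
near (0 : R)^'+ => t.
have t0 : 0 < t by near: t; exact: nbhs_right_gt.
have : K (k + t *: h) by near: t.
by move=> /Kys; rewrite dualD -ysk0 add0r dualZ pmulr_rge0.
Unshelve. all: by end_near. Qed.

End DualEvaluation.

(** All that both cases of weak duality need from the constraints: either form
of pseudo convexity forbids such a subgradient once z improves on y in the
scalarized objective. *)
Lemma feasible_MW_subgradient_ge0 {R : realType} {Z Y : normedModType R}
    {U : Type} {n : nat} {K : set Y} {f : Z -> Y} {g : 'I_n -> Z -> U -> R}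
    {z y : Z} {ys : dual Y} {mu : 'rV[R]_n} :
  feasible g z -> feasible_MW K f g (y, ys, mu) ->
  generalized_quasi_convex g y ->
  exists2 v, rsubdifferential (scalarize f ys) y v & 0 <= v (z - y).
Proof.
move=> zF [_ mu0 [us [usP [v vP v0]]] comp] gq.
exists v => //.
have : (v + \sum_(i < n) mu ord0 i *: us i) (z - y) = 0 by rewrite v0.
rewrite -[LHS]/(v (z - y) + (\sum_(i < n) mu ord0 i *: us i : dual Z) (z - y)).
rewrite dual_sumE => /eqP; rewrite addr_eq0 => /eqP ->.
rewrite oppr_ge0; apply: sumr_le0 => i _.
have [->|mui] := eqVneq (mu ord0 i) 0; first by rewrite mul0r.
have mui_gt0 : 0 < mu ord0 i by rewrite lt_neqAle eq_sym mui mu0.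
rewrite pmulr_rle0//; apply: weak_star_closure_convex_hull_le0 (usP i).
move=> w [u ui]; apply: gq; apply: (le_trans (zF u i)).
by have := comp i u ui; rewrite pmulr_rge0.
Qed.

Theorem theorem4p1 (R : realType) (Z Y : completeNormedModType R)
    (asplundZ : asplund Z) (asplundY : asplund Y)
    (f : Z -> Y) (f_lip : locally_lipschitz f)
    (K : set Y) (coneK : pointed_closed_convex_cone K)
    (U : topologicalType) (compactU : sequentially_compact U)
    (n : nat) (g : 'I_n -> Z -> U -> R)
    (z : Z) (zF : feasible g z)
    (y : Z) (ys : dual Y) (mu : 'rV[R]_n)
    (yF : feasible_MW K f g (y, ys, mu)) :
  (type_I_pseudo_convex K f g y ->
     ~ prec K (f z) (objective_MW f (y, ys, mu))) /\
  (type_II_pseudo_convex K f g y ->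
     ~ preceq K (f z) (objective_MW f (y, ys, mu))).
Proof.
have [ysK _ _ _] := yF; have [Kys _] := ysK.
split=> -[fpc gq].
  move=> [k Kk fzy].
  have [v vP] := feasible_MW_subgradient_ge0 zF yF gq.
  rewrite leNgt => /negP; apply; apply: fpc vP => //.
  rewrite /scalarize -subr_lt0 -dualB -fzy dualN oppr_lt0.
  exact: dual_cone_interior_gt0 ysK Kk.
move=> [[k Kk fzy] fzy0].
have [v vP] := feasible_MW_subgradient_ge0 zF yF gq.
rewrite leNgt => /negP; apply; apply: fpc vP => //.
  by apply/eqP => zy; apply: fzy0; rewrite /= zy subrr.
by rewrite /scalarize -subr_le0 -dualB -fzy dualN oppr_le0 Kys.
Qed.
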